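(* Let $p,k$ be positive integers with $k\le p$ and let $$T=\left\{(\boldsymbol\beta,\boldsymbol\mu,\boldsymbol z)\in\mathbb R^p\times\mathbb R_+^p\times\mathbb R^p:\ \sum_{i\in[p]}z_i\le k,\ \beta_i^2\le\mu_iz_i,\ z_i\in\{0,1\},\ \forall i\in[p]\right\}.$$ Then the convex hull of $T$ is $$\operatorname{conv}(T)=\left\{(\boldsymbol\beta,\boldsymbol\mu,\boldsymbol z)\in\mathbb R^p\times\mathbb R_+^p\times\mathbb R^p:\ \sum_{i\in[p]}z_i\le k,\ \beta_i^2\le\mu_iz_i,\ z_i\in[0,1],\ \forall i\in[p]\right\}.$$
   Context: $[p]=\{1,\dots,p\}$; $\mathbb R_+=[0,\infty)$. The set $T$ is the feasible region of the mixed integer second order conic reformulation of sparse ridge regression, in which $\mu_i$ is an upper bound on $\beta_i^2$. *)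

(* Defs.v *)
From mathcomp Require Import all_boot all_order all_algebra.
From mathcomp Require Import all_classical all_reals all_analysis.

Set Implicit Arguments.
Unset Strict Implicit.
Unset Printing Implicit Defensive.

Import Order.TTheory GRing.Theory Num.Theory.

Local Open Scope classical_set_scope.
Local Open Scope ring_scope.

Definition convex_hull (R : numDomainType) (M : lmodType R) (A : set M) :
    set M :=
  smallest (@convex_set R M) A.

Definition sparse_feasible (R : realType) (p k : nat) :
    set ('rV[R]_p * 'rV[R]_p * 'rV[R]_p) :=
  [set x : 'rV[R]_p * 'rV[R]_p * 'rV[R]_p | let: (beta, mu, z) := x in
     [/\ forall i, 0 <= mu 0 i,
         \sum_(i < p) z 0 i <= k%:R,
         forall i, beta 0 i ^+ 2 <= mu 0 i * z 0 i
       & forall i, z 0 i = 0 \/ z 0 i = 1]].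

Definition sparse_relaxation (R : realType) (p k : nat) :
    set ('rV[R]_p * 'rV[R]_p * 'rV[R]_p) :=
  [set x : 'rV[R]_p * 'rV[R]_p * 'rV[R]_p | let: (beta, mu, z) := x in
     [/\ forall i, 0 <= mu 0 i,
         \sum_(i < p) z 0 i <= k%:R,
         forall i, beta 0 i ^+ 2 <= mu 0 i * z 0 i
       & forall i, 0 <= z 0 i <= 1]].

(* Main.v *)
(* The relaxation is convex because [b^2 <= m z] with [m, z >= 0] is a rotated
   second-order cone.  Conversely, a point [(b, m, z)] of the relaxation is the
   value at [w = z] of the affine map
   [w |-> (b_i w_i / z_i, m_i w_i / z_i, w)], which sends every binary [w] with
   [sum w <= k] and support inside that of [z] to a feasible point.  It thus
   suffices that [z] is a convex combination of such [w].  This follows by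
   induction on the number of fractional coordinates: if there are two, shift
   mass between them in both directions until one becomes binary; if there is
   only one, it can be rounded both up and down because [k] is an integer. *)
Require Import Defs.
From mathcomp Require Import all_boot all_order all_algebra.
From mathcomp Require Import all_classical all_reals all_analysis.
From mathcomp Require Import ring lra.

Set Implicit Arguments.
Unset Strict Implicit.
Unset Printing Implicit Defensive.

Import Order.TTheory GRing.Theory Num.Theory.

Local Open Scope classical_set_scope.
Local Open Scope ring_scope.

Lemma convex_set_combP (R : numDomainType) (M : lmodType R) (A : set M) :
  @convex_set R M A <->
  forall x y a, A x -> A y -> 0 <= a <= 1 -> A (a *: x + (1 - a) *: y).
Proof.
split=> [cA x y a Ax Ay a01|cA x y l]; last first.
  by rewrite !inE => Ax Ay; apply: cA => //; rewrite ge0 le1.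
by have := cA x y (Itv01 (andP a01).1 (andP a01).2); rewrite !inE; exact.
Qed.

(** The weights [t / (s + t)] and [s / (s + t)] cancel the two multiples of [d]. *)
Lemma convex_set_between (R : numFieldType) (M : lmodType R) (A : set M)
    (x d : M) (s t : R) :
  @convex_set R M A -> 0 < s -> 0 < t ->
  A (x + s *: d) -> A (x - t *: d) -> A x.
Proof.
move=> /convex_set_combP cA s0 t0 Ap Am.
have st0 : 0 < s + t by exact: addr_gt0.
have stN0 : s + t != 0 by rewrite gt_eqF.
have -> : x = (t / (s + t)) *: (x + s *: d)
    + (1 - t / (s + t)) *: (x - t *: d).
  rewrite !scalerDr addrACA -scalerDl subrKC scale1r -scaleNr !scalerA.
  rewrite -scalerDl.
  have -> : t / (s + t) * s + (1 - t / (s + t)) * - t = 0 by field.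
  by rewrite scale0r addr0.
apply: cA => //; rewrite ler_pdivrMr// mul1r lerDr (ltW s0) andbT.
by rewrite divr_ge0// ltW.
Qed.

(** Arithmetic-geometric mean: [(b b')^2 <= (m z') (m' z)], and four times this product is at most
    [(m z' + m' z)^2]. This controls the cross term when [b] and [b'] are mixed. *)
Lemma double_mul_le_cross (R : realDomainType) (b b' m m' z z' : R) :
  0 <= m -> 0 <= m' -> 0 <= z -> 0 <= z' ->
  b ^+ 2 <= m * z -> b' ^+ 2 <= m' * z' -> 2 * (b * b') <= m * z' + m' * z.
Proof.
move=> m0 m'0 z0 z'0 bmz bmz'.
apply: le_trans (ler_norm _) _.
rewrite -ler_sqr ?nnegrE ?addr_ge0 ?mulr_ge0// real_normK ?num_real//.
have : b ^+ 2 * b' ^+ 2 <= (m * z) * (m' * z') by rewrite ler_pM ?sqr_ge0.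
have := sqr_ge0 (m * z' - m' * z).
by nra.
Qed.

Lemma convex_set_sparse_relaxation (R : realType) (p k : nat) :
  @convex_set R _ (@sparse_relaxation R p k).
Proof.
apply/convex_set_combP => -[[b m] z] [[b' m'] z'] a.
move=> [m0 zk bmz z01] [m'0 z'k bmz' z'01] /andP[a0 a1].
have c0 : 0 <= 1 - a by rewrite subr_ge0.
split=> [i||i|i]; rewrite ?mxE.
- by rewrite addr_ge0// mulr_ge0.
- under eq_bigr do rewrite !mxE.
  rewrite big_split/= -!mulr_sumr.
  have := ler_wpM2l a0 zk; have := ler_wpM2l c0 z'k; lra.
- have /andP[zi _] := z01 i; have /andP[z'i _] := z'01 i.
  have cross := double_mul_le_cross (m0 i) (m'0 i) zi z'i (bmz i) (bmz' i).
  (* The three weighted inequalities add up to the expansion of the cone constraint at the combined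
     point. *)
  have := ler_wpM2l (mulr_ge0 a0 c0) cross.
  have := ler_wpM2l (mulr_ge0 a0 a0) (bmz i).
  have := ler_wpM2l (mulr_ge0 c0 c0) (bmz' i).
  lra.
- have /andP[zi zi1] := z01 i; have /andP[z'i z'i1] := z'01 i.
  by nra.
Qed.

Section BoundedSumBox.
Variables (R : realFieldType) (p : nat).
Implicit Types (z w : 'rV[R]_p) (D : set 'rV[R]_p).

Definition fractional z : {set 'I_p} :=
  [set i | (z 0 i != 0) && (z 0 i != 1)].

Lemma fractionalPn z i :
  reflect (z 0 i = 0 \/ z 0 i = 1) (i \notin fractional z).
Proof.
rewrite inE negb_and !negbK.
by apply: (iffP orP) => -[] /eqP; [left|right|left|right].
Qed.

(** Coordinates that are already binary stay frozen; in particular the support of [w] lies inside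
    that of [z]. *)
Definition agree_off_fractional z w :=
  forall i, i \notin fractional z -> w 0 i = z 0 i.

Lemma agree_off_fractional_sub z w :
  agree_off_fractional z w -> fractional w \subset fractional z.
Proof.
move=> zw; apply/fintype.subsetP => i; apply: contraLR => iz.
by apply/fractionalPn; rewrite (zw _ iz); apply/fractionalPn.
Qed.

Lemma agree_off_fractional_trans z w v :
  agree_off_fractional z w -> agree_off_fractional w v ->
  agree_off_fractional z v.
Proof.
move=> zw wv i iz; rewrite wv ?zw//.
by apply: contra iz; exact: (fintype.subsetP (agree_off_fractional_sub zw)).
Qed.

Lemma agree_off_fractional_lt z w i :
  agree_off_fractional z w -> i \in fractional z -> i \notin fractional w ->
  (#|fractional w| < #|fractional z|)%N.
Proof.
move=> zw iz iw; apply: proper_card; apply/properP; split.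
  exact: agree_off_fractional_sub.
by exists i.
Qed.

Lemma shift_to_boundary z i j :
  (forall l, 0 <= z 0 l <= 1) -> i \in fractional z -> j \in fractional z ->
  i != j ->
  exists s, let w := z + s *: (delta_mx 0 i - delta_mx 0 j) in
    [/\ 0 < s, forall l, 0 <= w 0 l <= 1, agree_off_fractional z w,
        \sum_l w 0 l = \sum_l z 0 l
      & (#|fractional w| < #|fractional z|)%N].
Proof.
move=> z01 iz jz ij.
have frac l : l \in fractional z -> 0 < z 0 l < 1.
  rewrite inE => /andP[l0 l1]; have /andP[zl0 zl1] := z01 l.
  by rewrite !lt_neqAle eq_sym l0 zl0 l1 zl1.
have /andP[zi0 zi1] := frac i iz; have /andP[zj0 zj1] := frac j jz.
(* The longest step that stays in the box: coordinate [i] reaches 1 or coordinate [j] reaches 0. *)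
pose s := Num.min (1 - z 0 i) (z 0 j).
have s0 : 0 < s by rewrite lt_min subr_gt0 zi1.
have si : s <= 1 - z 0 i by rewrite ge_min lexx.
have sj : s <= z 0 j by rewrite ge_min lexx orbT.
exists s => w.
have wi : w 0 i = z 0 i + s.
  by rewrite !mxE !eqxx (negbTE ij) subr0 mulr1.
have wj : w 0 j = z 0 j - s.
  by rewrite !mxE !eqxx eq_sym (negbTE ij) sub0r mulrN1.
have wl l : l != i -> l != j -> w 0 l = z 0 l.
  by move=> li lj; rewrite !mxE eqxx (negbTE li) (negbTE lj) subr0 mulr0 addr0.
have zw : agree_off_fractional z w.
  move=> l lz; apply: wl; apply: contraNneq lz => -> //.
split => //.
- move=> l; have [->|li] := eqVneq l i; first by rewrite wi; lra.
  have [->|lj] := eqVneq l j; first by rewrite wj; lra.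
  by rewrite wl.
- rewrite (bigD1 i)//= (bigD1 j) 1?eq_sym//= [RHS](bigD1 i)//=.
  rewrite [in RHS](bigD1 j) 1?eq_sym//= wi wj.
  under eq_bigr => l /andP[li lj] do rewrite wl//.
  by ring.
- have [sE|sE] : s = 1 - z 0 i \/ s = z 0 j.
  + by rewrite /s; case: ltP; [left|right].
  + apply: (agree_off_fractional_lt zw iz); apply/fractionalPn; right.
    by rewrite wi sE addrC subrK.
  + apply: (agree_off_fractional_lt zw jz); apply/fractionalPn; left.
    by rewrite wj sE subrr.
Qed.

(* The other coordinates sum to an integer less than [k]. *)
Lemma round_up_single_fractional (k : nat) z i :
  \sum_l z 0 l <= k%:R -> 0 < z 0 i ->
  (forall l, l != i -> z 0 l = 0 \/ z 0 l = 1) ->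
  1 + \sum_(l | l != i) z 0 l <= k%:R.
Proof.
rewrite (bigD1 i)//= => zk zi0 zB.
pose is1 l := z 0 l == 1.
have zE : \sum_(l | l != i) z 0 l = (\sum_(l | l != i) is1 l)%N%:R.
  rewrite natr_sum; apply: eq_bigr => l /zB[] zl; rewrite /is1 zl ?eqxx//.
  by rewrite eq_sym oner_eq0.
by rewrite zE in zk *; rewrite nat1r ler_nat -(ltr_nat R); lra.
Qed.

(** Stated for an arbitrary convex [D], so that it applies to the preimage of a convex set under an
    affine map. *)
Lemma bounded_sum_box_hull (k : nat) D z :
  @convex_set R _ D ->
  (forall l, 0 <= z 0 l <= 1) -> \sum_l z 0 l <= k%:R ->
  (forall w, fractional w = finset.set0 -> \sum_l w 0 l <= k%:R ->
     agree_off_fractional z w -> D w) ->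
  D z.
Proof.
move=> cD; have [n] := ubnP #|fractional z|.
elim: n z => // n IH z zn z01 zk Dz.
have step w : (#|fractional w| < #|fractional z|)%N ->
    (forall l, 0 <= w 0 l <= 1) -> \sum_l w 0 l <= k%:R ->
    agree_off_fractional z w -> D w.
  move=> wz w01 wk zw; apply: IH => //; first exact: leq_trans wz _.
  by move=> v v0 vk wv; apply: Dz => //; exact: agree_off_fractional_trans wv.
have [z0|[i iz]] := set_0Vmem (fractional z); first exact: Dz.
have [[j /andP[ji jz]]|single] :=
  pselect (exists j, (j != i) && (j \in fractional z)).
  have [|s [s0 ws zws sum_s frac_s]] := shift_to_boundary z01 iz jz.
    by rewrite eq_sym.
  have [t [t0 wt zwt sum_t frac_t]] := shift_to_boundary z01 jz iz ji.
  (* Swapping [i] and [j] reverses the direction, so [z] lies between the two shifted points. *)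
  apply: (convex_set_between cD s0 t0).
    by apply: step frac_s _ _ _ => //; rewrite sum_s.
  rewrite -scalerN opprB.
  by apply: step frac_t _ _ _ => //; rewrite sum_t.
have zB l : l != i -> z 0 l = 0 \/ z 0 l = 1.
  move=> li; apply/fractionalPn/negP => lz.
  by apply: single; exists l; rewrite li.
have /andP[zi0 zi1] : 0 < z 0 i < 1.
  move: iz; rewrite inE => /andP[i0 i1]; have /andP[zi0 zi1] := z01 i.
  by rewrite !lt_neqAle eq_sym i0 zi0 i1 zi1.
have up := round_up_single_fractional zk zi0 zB.
(* Both roundings respect the bound on the sum, since by [up] even [c = 1] does. *)
have round t c : z 0 i + t = c -> c = 0 \/ c = 1 -> c <= 1 ->
    D (z + t *: delta_mx 0 i).
  move=> ct c01 c1; set w := _ + _.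
  have wi : w 0 i = c by rewrite !mxE !eqxx mulr1.
  have wl l : l != i -> w 0 l = z 0 l.
    by move=> li; rewrite !mxE (negbTE li) mulr0 addr0.
  have zw : agree_off_fractional z w.
    by move=> l lz; apply: wl; apply: contraNneq lz => ->.
  apply: step => //.
  - by apply: (agree_off_fractional_lt zw iz); apply/fractionalPn; rewrite wi.
  - move=> l; have [->|/wl->//] := eqVneq l i; rewrite wi.
    by case: c01 => ->; rewrite ?lexx ?ler01.
  - rewrite (bigD1 i)//= wi; under eq_bigr do rewrite wl//.
    by apply: le_trans up; rewrite lerD2r.
apply: (@convex_set_between _ _ _ z (delta_mx 0 i) (1 - z 0 i) (z 0 i)) => //.
- by rewrite subr_gt0.
- by apply: (round _ 1) => //; [rewrite addrC subrK|right].
- by rewrite -scaleNr; apply: (round _ 0) => //; [rewrite subrr|left].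
Qed.

End BoundedSumBox.

Theorem proposition3 (R : realType) (p k : nat)
    (hk : (0 < k)%N) (hkp : (k <= p)%N) :
  convex_hull (@sparse_feasible R p k) = @sparse_relaxation R p k.
Proof.
apply/seteqP; split.
  apply: smallest_sub; first exact: convex_set_sparse_relaxation.
  move=> [[b m] z] [m0 zk bmz zB]; split => // i.
  by case: (zB i) => ->; rewrite ?lexx ler01.
move=> [[b m] z] [m0 zk bmz z01] C [cC TC].
(* The summand [(z 0 i == 0)%:R] keeps [mu] fixed where [z] vanishes; there
   [w 0 i / z 0 i] is [0]. *)
pose lift (w : 'rV[R]_p) : 'rV[R]_p * 'rV[R]_p * 'rV[R]_p :=
  (\row_i (b 0 i * (w 0 i / z 0 i)),
   \row_i (m 0 i * (w 0 i / z 0 i + (z 0 i == 0)%:R)), w).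
have -> : (b, m, z) = lift z.
  congr (_, _, _); apply/rowP => i; rewrite !mxE.
    (* Where [z] vanishes, the cone constraint forces [b 0 i = 0]. *)
    have [zi|zi] := eqVneq (z 0 i) 0; last by rewrite divff// mulr1.
    have := bmz i; rewrite zi mulr0 mul0r mulr0 => bi.
    by apply/eqP; rewrite -sqrf_eq0 eq_le bi sqr_ge0.
  have [->|zi] := eqVneq (z 0 i) 0; first by rewrite mul0r add0r mulr1.
  by rewrite divff// addr0 mulr1.
apply: (bounded_sum_box_hull (D := lift @^-1` C) _ z01 zk).
  apply/convex_set_combP => v w a Cv Cw a01.
  rewrite /preimage/=.
  (* [lift] is affine because [z] is fixed: its inverse entries are mere constants. *)
  have -> : lift (a *: v + (1 - a) *: w) = a *: lift v + (1 - a) *: lift w.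
    by congr (_, _, _); apply/rowP => i; rewrite !mxE;
      move: (z 0 i)^-1 => c; ring.
  by move/convex_set_combP : cC; apply.
move=> w w0 wk zw; apply: TC.
have wB i : w 0 i = 0 \/ w 0 i = 1.
  by apply/fractionalPn; rewrite w0 finset.in_set0.
have zi0 i : 0 <= z 0 i by have /andP[] := z01 i.
have w_supp i : z 0 i = 0 -> w 0 i = 0.
  by move=> zi; rewrite zw//; apply/fractionalPn; left.
split => // i; rewrite !mxE.
  rewrite mulr_ge0// addr_ge0 ?ler0n// divr_ge0//.
  by case: (wB i) => ->; rewrite ?ler01.
case: (wB i) => wi; rewrite wi; first by rewrite !(mul0r, mulr0) expr0n.
(* With [w 0 i = 1], the goal is [b^2 <= m z] divided by [z^2]. *)
have zi : z 0 i != 0.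
  by apply/eqP => /w_supp; rewrite wi => /eqP; rewrite oner_eq0.
have zi_gt0 : 0 < z 0 i by rewrite lt_neqAle eq_sym zi zi0.
rewrite (negbTE zi) addr0 mul1r mulr1 exprMn exprVn.
rewrite ler_pdivrMr ?exprn_gt0//.
by have -> : m 0 i / z 0 i * z 0 i ^+ 2 = m 0 i * z 0 i by field.
Qed.
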